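(* Let $\Gamma$ be a labeled $\mathbb{Z}^d$-periodic graph. If every spectral band function of $\Gamma$ is a perfect Morse function, then every spectral band function of a parallel extension $\Gamma_a$ ($a$ a nonzero real number) of $\Gamma$ is a perfect Morse function.
   Context: Let $d>0$ be an integer and $\mathbb{T}$ the unit complex numbers. A $\mathbb{Z}^d$-periodic graph $\Gamma$ is a graph with vertex set $\mathcal{V}$ and edge set $\mathcal{E}$, equipped with a free cocompact action of $\mathbb{Z}^d$ (finitely many orbits on $\mathcal{V}$ and on $\mathcal{E}$); the action of $\alpha\in\mathbb{Z}^d$ on $v$ is written $\alpha+v$. $W\subset\mathcal{V}$ is a finite set of orbit representatives. A labeling is a pair $(V,E)$ of $\mathbb{Z}^d$-periodic functions $V\colon\mathcal{V}\to\mathbb{R}$, $E\colon\mathcal{E}\to\mathbb{R}$ (edges undirected). The Floquet matrix $H(z)$, $z=(z_1,\dots,z_d)$, is the $|W|\times|W|$ matrix with $(v,u)$-entry $V(v)\delta_{v,u}+\sum_{(v,\alpha+u)\in\mathcal{E}}E(v,\alpha+u)z^\alpha$, where $z^\alpha=z_1^{\alpha_1}\cdots z_d^{\alpha_d}$. For $z\in\mathbb{T}^d$, $H(z)$ is Hermitian; its ordered eigenvalues $\lambda_1(z)\le\dots\le\lambda_{|W|}(z)$ are the spectral band functions $\mathbb{T}^d\to\mathbb{R}$. A function on a compact manifold $M$ is Morse if all of its critical points are nondegenerate; it is a perfect Morse function if moreover its number of critical points equals the sum of the Betti numbers of $M$ (which is $2^n$ for $M=\mathbb{T}^n$). Parallel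 extension: for real $a\ne0$, $\mathbb{Z}_a$ is the infinite path with vertex set $\mathbb{Z}$ and an edge labeled $a$ between $n$ and $n+1$ for each $n\in\mathbb{Z}$. The parallel extension $\Gamma_a=\mathbb{Z}_a\times\Gamma$ is the product graph, with vertex set $\mathbb{Z}\times\mathcal{V}$, edges $(n,v)\sim(n+1,v)$ labeled $a$ and edges $(n,v)\sim(n,u)$ labeled $E(v,u)$ for $(v,u)\in\mathcal{E}$, and potential $V(n,v)=V(v)$. It is a labeled $\mathbb{Z}^{d+1}$-periodic graph, where the last coordinate of $\mathbb{Z}^{d+1}$ acts by translation on $\mathbb{Z}$. Its Floquet matrix is obtained from $H(z)$ by adding $a(z_{d+1}+z_{d+1}^{-1})$ to each diagonal entry. *)

(* Defs.v *)
From HB Require Import structures.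
From mathcomp Require Import all_boot all_order all_algebra.
From mathcomp Require Import complex.
From mathcomp Require Import all_classical all_reals all_analysis.
Import Order.TTheory GRing.Theory Num.Theory.
Import numFieldNormedType.Exports.

Set Implicit Arguments.
Unset Strict Implicit.
Unset Printing Implicit Defensive.

Local Open Scope classical_set_scope.
Local Open Scope ring_scope.

(** * Morse functions on the torus *)

Section Torus.
Variables (R : realType) (n : nat).
Implicit Types (z : 'rV[R[i]]_n) (f : 'rV[R[i]]_n -> R) (g : 'rV[R]_n -> R).

Definition torus : set 'rV[R[i]]_n := [set z | forall k, `|z 0 k| = 1].

(* [torus_chart z] is the covering map R^n -> T^n sending t to
   (z_k * exp(i t_k))_k. Restricted to a small ball around 0 it is a smooth
   parametrization of T^n around [z = torus_chart z 0]. *)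
Definition torus_chart z (t : 'rV[R]_n) : 'rV[R[i]]_n :=
  \row_k (z 0 k * (cos (t 0 k) +i* sin (t 0 k))%C).

Definition partial (k : 'I_n) g : 'rV[R]_n -> R :=
  fun x => 'D_(delta_mx 0 k) g x.

Definition iter_partial (s : seq 'I_n) g := foldr partial g s.

Definition smooth g := forall (s : seq 'I_n) x, differentiable (iter_partial s g) x.

(* A function on T^n is represented by a function on the ambient space C^n;
   only its values on [torus] are used below. *)
Definition torus_smooth f := forall z, torus z -> smooth (f \o torus_chart z).

Definition critical_points f : set 'rV[R[i]]_n :=
  [set z | torus z /\ forall k, partial k (f \o torus_chart z) 0 = 0].

Definition hessian f z : 'M[R]_n :=
  \matrix_(k, l) partial k (partial l (f \o torus_chart z)) 0.

Definition morse f :=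
  torus_smooth f /\ forall z, critical_points f z -> \det (hessian f z) != 0.

(* The Betti numbers of T^n are the binomial coefficients 'C(n, k); their sum
   is 2 ^ n. *)
Definition perfect_morse f := morse f /\ (critical_points f #= `I_(2 ^ n))%card.

End Torus.

(** * Labeled periodic graphs *)

(* The edge set is given by a symmetric relation, so it contains at most one
   edge between two vertices; loops are allowed. The action on edges is the one
   induced by the action on vertices. The finite set W of orbit representatives
   is enumerated by [rep]: it meets each orbit exactly once. *)
Record periodic_graph (d : nat) := PeriodicGraph {
  vertex :> Type;
  act : 'rV[int]_d -> vertex -> vertex;
  adj : vertex -> vertex -> Prop;
  act0 : forall v, act 0 v = v;
  actD : forall x y v, act (x + y) v = act x (act y v);
  act_free : forall x v, act x v = v -> x = 0;
  adj_sym : forall v u, adj v u -> adj u v;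
  adj_act : forall x v u, adj v u -> adj (act x v) (act x u);
  nrep : nat;
  rep : 'I_nrep -> vertex;
  rep_orbit : forall v, exists! w, exists x, v = act x (rep w);
  edge_orbits : exists (N : nat) (e : 'I_N -> vertex * vertex),
    forall v u, adj v u -> exists i x, v = act x (e i).1 /\ u = act x (e i).2
}.

(* [elabel v u] is the label of the edge between v and u; its value is
   meaningless when v and u are not adjacent. *)
Record labeling (R : realType) (d : nat) (G : periodic_graph d) := Labeling {
  potential : G -> R;
  elabel : G -> G -> R;
  potential_act : forall x v, potential (act x v) = potential v;
  elabel_sym : forall v u, adj v u -> elabel v u = elabel u v;
  elabel_act : forall x v u,
    adj v u -> elabel (act x v) (act x u) = elabel v u
}.

Section Floquet.
Variables (R : realType) (d : nat) (G : periodic_graph d) (L : labeling R G).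

Definition zmonomial (z : 'rV[R[i]]_d) (x : 'rV[int]_d) : R[i] :=
  \prod_(k < d) z 0 k ^ x 0 k.

(* The set of indices of the inner sum is finite because there are finitely
   many orbits of edges and the action is free. *)
Definition floquet (z : 'rV[R[i]]_d) : 'M[R[i]]_(nrep G) :=
  \matrix_(v, u)
    (((potential L (rep v))%:C)%C *+ (v == u) +
     \sum_(x \in [set x : 'rV[int]_d | adj (rep v) (act x (rep u))])
        ((elabel L (rep v) (act x (rep u)))%:C)%C * zmonomial z x).

End Floquet.

Section Eigenvalues.
Variables (R : realType) (m : nat).

(* The roots of the characteristic polynomial, with multiplicities. *)
Definition eigenvalues (A : 'M[R[i]]_m) : seq R[i] :=
  sval (closed_field_poly_normal (char_poly A)).

(* Meant for Hermitian matrices, whose eigenvalues are equal to their real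
   parts. *)
Definition ordered_eigenvalues (A : 'M[R[i]]_m) : seq R :=
  sort <=%R [seq complex.Re x | x <- eigenvalues A].

End Eigenvalues.

(* The j-th spectral band function, with j counted from 0. *)
Definition band (R : realType) (d : nat) (G : periodic_graph d)
    (L : labeling R G) (j : 'I_(nrep G)) (z : 'rV[R[i]]_d) : R :=
  nth 0 (ordered_eigenvalues (floquet L z)) j.

(** * Parallel extensions *)

Section Parallel.
Variables (R : realType) (d : nat) (G : periodic_graph d).
Implicit Types (x y : 'rV[int]_d.+1) (p q : int * G).

(* [col' ord_max x] consists of the first d coordinates of x, and [x 0 ord_max]
   is the last one. *)
Definition par_act x p : int * G :=
  (x 0 ord_max + p.1, act (col' ord_max x) p.2).

Definition par_adj p q : Prop :=
  (p.2 = q.2 /\ (q.1 = p.1 + 1 \/ p.1 = q.1 + 1)) \/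
  (p.1 = q.1 /\ adj p.2 q.2).

Definition par_rep (w : 'I_(nrep G)) : int * G := (0, rep w).

Lemma par_act0 p : par_act 0 p = p.
Proof.
case: p => n v; rewrite /par_act /= mxE add0r; congr pair.
by rewrite -[RHS]act0; congr act; apply/rowP => k; rewrite !mxE.
Qed.

Lemma par_actD x y p : par_act (x + y) p = par_act x (par_act y p).
Proof.
case: p => n v; rewrite /par_act /= mxE addrA; congr pair.
by rewrite -actD; congr act; apply/rowP => k; rewrite !mxE.
Qed.

Lemma par_act_free x p : par_act x p = p -> x = 0.
Proof.
case: p => n v [/eqP]; rewrite -subr_eq0 addrK => /eqP x0 /act_free xE.
apply/rowP => k; rewrite mxE; case: (unliftP ord_max k) => [l|] -> //.
by move/rowP: xE => /(_ l); rewrite !mxE.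
Qed.

Lemma par_adj_sym p q : par_adj p q -> par_adj q p.
Proof.
case: p q => [n v] [m u] [[/= -> h]|[/= -> h]].
  by left; split=> //; case: h; [right|left].
by right; split=> //; apply: adj_sym.
Qed.

Lemma par_adj_act x p q : par_adj p q -> par_adj (par_act x p) (par_act x q).
Proof.
case=> [[h1 h2]|[h1 h2]]; last by right; rewrite /= h1; split=> //; apply: adj_act.
by left; rewrite /= h1; split=> //; case: h2 => ->; rewrite addrA; [left|right].
Qed.

Let par_vec (n : int) (x : 'rV[int]_d) : 'rV[int]_d.+1 :=
  \row_k (if unlift ord_max k is Some l then x 0 l else n).

Let par_vec_act n (x : 'rV[int]_d) p : par_act (par_vec n x) p = (n + p.1, act x p.2).
Proof.
rewrite /par_act mxE unlift_none; congr (_, act _ _).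
by apply/rowP => k; rewrite !mxE liftK.
Qed.

Lemma par_rep_orbit p : exists! w, exists x, p = par_act x (par_rep w).
Proof.
case: p => n v; have [w [[x ->] wU]] := rep_orbit v; exists w; split.
  by exists (par_vec n x); rewrite par_vec_act /= addr0.
by move=> w' [y [_ h]]; apply: wU; exists (col' ord_max y).
Qed.

Lemma par_edge_orbits : exists (N : nat) (e : 'I_N -> (int * G) * (int * G)),
  forall p q, par_adj p q ->
    exists i x, p = par_act x (e i).1 /\ q = par_act x (e i).2.
Proof.
have [N [e eP]] := edge_orbits G.
pose f (s : 'I_(nrep G) + 'I_(nrep G) + 'I_N) : (int * G) * (int * G) :=
  match s with
  | inl (inl w) => ((0, rep w), (1, rep w))
  | inl (inr w) => ((1, rep w), (0, rep w))
  | inr i => ((0, (e i).1), (0, (e i).2))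
  end.
exists #|{: 'I_(nrep G) + 'I_(nrep G) + 'I_N}|, (f \o enum_val).
move=> [n v] [m u].
suff h : par_adj (n, v) (m, u) ->
    exists s x, (n, v) = par_act x (f s).1 /\ (m, u) = par_act x (f s).2.
  by move=> /h[s sP]; exists (enum_rank s); rewrite /= enum_rankK.
case=> /= [[-> [->|->]]|[-> /eP[i [x [-> ->]]]]].
- have [w [[x ->] _]] := rep_orbit u; exists (inl (inl w)), (par_vec n x).
  by rewrite !par_vec_act /= addr0.
- have [w [[x ->] _]] := rep_orbit u; exists (inl (inr w)), (par_vec m x).
  by rewrite !par_vec_act /= addr0.
- by exists (inr i), (par_vec m x); rewrite !par_vec_act /= addr0.
Qed.

Definition parallel_graph : periodic_graph d.+1 :=
  @PeriodicGraph d.+1 (int * G)%type par_act par_adj par_act0 par_actD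
    par_act_free par_adj_sym par_adj_act (nrep G) par_rep par_rep_orbit
    par_edge_orbits.

Variables (L : labeling R G) (a : R).

Definition par_potential p : R := potential L p.2.

(* Adjacent vertices of the product graph have the same first component
   exactly when the edge comes from G. *)
Definition par_elabel p q : R := if p.1 == q.1 then elabel L p.2 q.2 else a.

Lemma par_potential_act x p : par_potential (par_act x p) = par_potential p.
Proof. exact: potential_act. Qed.

Let par_adj_fst p q : par_adj p q -> p.1 == q.1 -> adj p.2 q.2.
Proof.
case=> [[_ [->|->]]|[_ //]]; last by rewrite -subr_eq0 addrAC subrr add0r.
by rewrite eq_sym -subr_eq0 addrAC subrr add0r.
Qed.

Lemma par_elabel_sym p q : par_adj p q -> par_elabel p q = par_elabel q p.
Proof.
rewrite /par_elabel [q.1 == _]eq_sym => pq; case: ifPn => // /(par_adj_fst pq).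
exact: elabel_sym.
Qed.

Lemma par_elabel_act x p q :
  par_adj p q -> par_elabel (par_act x p) (par_act x q) = par_elabel p q.
Proof.
rewrite /par_elabel /= (inj_eq (addrI _)) => pq.
by case: ifPn => // /(par_adj_fst pq); apply: elabel_act.
Qed.

Definition parallel_labeling : labeling R parallel_graph :=
  @Labeling R d.+1 parallel_graph par_potential par_elabel par_potential_act
    par_elabel_sym par_elabel_act.

End Parallel.

(* Main.v *)
From HB Require Import structures.
Require Import Defs.
From mathcomp Require Import all_boot all_order all_algebra complex ring.
From mathcomp Require Import all_classical all_reals all_analysis.
Import Order.TTheory GRing.Theory Num.Theory numFieldNormedType.Exports.

(** On the torus the Floquet matrix of the parallel extension is that of the
    graph plus the real scalar [2 a Re z_{d+1}], so each band function is
    [f (z', z_{d+1}) = g z' + 2 a Re z_{d+1}] with [g] a band function of the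
    graph. In the charts of the torus this is a sum of two functions of separate
    variables, the second one being [b cos s + c sin s]. Hence [z] is critical
    for [f] iff [z'] is critical for [g] and [z_{d+1} = 1] or [-1], which
    doubles the number of critical points, and the Hessian of [f] there is block
    diagonal with nonzero last entry [-2 a z_{d+1}]. *)

Set Implicit Arguments.
Unset Strict Implicit.
Unset Printing Implicit Defensive.
Local Open Scope classical_set_scope.
Local Open Scope ring_scope.

(** * Row vectors split into their first coordinates and the last one *)

Section RowRcons.
Variables (T : Type) (n : nat).
Implicit Types (w : 'rV[T]_n) (x y : 'rV[T]_n.+1) (e : T).

Definition row_rcons w e : 'rV[T]_n.+1 :=
  \row_k (if unlift ord_max k is Some l then w 0 l else e).

Lemma col'_row_rcons w e : col' ord_max (row_rcons w e) = w.
Proof. by apply/rowP => l; rewrite !mxE liftK. Qed.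

Lemma row_rcons_last w e : row_rcons w e 0 ord_max = e.
Proof. by rewrite mxE unlift_none. Qed.

Lemma row_lastP x y :
  col' ord_max x = col' ord_max y -> x 0 ord_max = y 0 ord_max -> x = y.
Proof.
move=> /rowP xy xy1; apply/rowP => k; case: (unliftP ord_max k) => [l|] -> //.
by have := xy l; rewrite !mxE.
Qed.

End RowRcons.

(** * Differential calculus of sums of functions of separate variables *)

(** By linearity of [h] the two difference quotients are the same function of [e], so no
    differentiability of [u] is assumed. *)
Lemma derive_comp_linear (R : numFieldType) (U V W : normedModType R)
    (h : {linear U -> V}) (u : V -> W) (x v : U) :
  'D_v (u \o h) x = 'D_(h v) u (h x).
Proof.
rewrite /derive; set F := (F in lim (F @ _)).
have -> // : F = fun e => e^-1 *: ((u \o shift (h x)) (e *: h v) - u (h x)).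
by apply/funext => e; rewrite /F /= [h (_ + _)]linearP.
Qed.

(** Deleting a column cannot increase the entrywise distance, so the same radius works. *)
Lemma continuous_col' (R : numFieldType) (m n : nat) (k : 'I_n) :
  continuous (@col' R m n k).
Proof.
move=> u A /nbhs_ballP[e /= e0 eA]; apply/nbhs_ballP; exists e => //= v [_ uv].
by apply: eA; split=> // i j; rewrite !mxE; apply: uv.
Qed.

Section SeparatedSums.
Variables (R : realType) (n : nat).
Implicit Types (u : 'rV[R]_n -> R) (b c s : R) (t : 'rV[R]_n.+1).

(** Two coefficients make the family closed under differentiation: it sends [(b, c)] to
    [(c, - b)]. *)
Definition trig b c s := b * cos s + c * sin s.

Definition separated_sum u b c t :=
  u (col' ord_max t) + trig b c (t 0 ord_max).

Lemma is_derive_trig b c s : is_derive s 1 (trig b c) (trig c (- b) s).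
Proof.
rewrite /trig; have -> : c * cos s + - b * sin s = b *: (- sin s) + c *: cos s.
  by rewrite addrC scalerN -scaleNr.
rewrite (_ : (fun _ => _) = b \*: cos + c \*: sin); last by apply/funext.
exact: is_deriveD.
Qed.

Let dcol' t : differentiable (col' ord_max : 'rV[R]_n.+1 -> 'rV[R]_n) t.
Proof. exact/linear_differentiable/continuous_col'. Qed.

(** Named so that a linear structure can be attached to it, as [derive_comp_linear] requires. *)
Let lastco : 'rV[R]_n.+1 -> R := fun t => t 0 ord_max.

Let lastco_linear : linear lastco.
Proof. by move=> b x y; rewrite /lastco !mxE. Qed.

HB.instance Definition _ :=
  GRing.isLinear.Build R 'rV[R]_n.+1 R _ lastco lastco_linear.

Let separated_sumE u b c :
  separated_sum u b c = (u \o col' ord_max) + (trig b c \o lastco).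
Proof. by []. Qed.

Let dtrig b c t : differentiable (trig b c \o lastco) t.
Proof.
apply: differentiable_comp; first exact: differentiable_coord.
by apply/derivable1_diffP; have [] := is_derive_trig b c (lastco t).
Qed.

Lemma differentiable_separated_sum u b c t :
  (forall x, differentiable u x) -> differentiable (separated_sum u b c) t.
Proof.
by move=> du; rewrite separated_sumE; apply: differentiableD => //;
  apply: differentiable_comp.
Qed.

Let derive_separated_sum u b c t v : (forall x, differentiable u x) ->
  'D_v (separated_sum u b c) t =
  'D_(col' ord_max v) u (col' ord_max t) +
  'D_(v 0 ord_max) (trig b c) (t 0 ord_max).
Proof.
move=> du; rewrite separated_sumE deriveD.
- by rewrite !derive_comp_linear.
- by apply: diff_derivable; apply: differentiable_comp.
- exact: diff_derivable.
Qed.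

Lemma partial_separated_sum_lift u b c (l : 'I_n) :
  (forall x, differentiable u x) ->
  partial (lift ord_max l) (separated_sum u b c) =
  separated_sum (partial l u) 0 0.
Proof.
move=> du; apply/funext => t.
rewrite /partial derive_separated_sum //.
have -> : col' ord_max (delta_mx 0 (lift ord_max l)) = delta_mx 0 l :> 'rV[R]_n.
  by apply/rowP => k; rewrite !mxE !eqxx (inj_eq lift_inj).
rewrite !mxE eqxx (negPf (neq_lift _ _)) derive0.
by rewrite /separated_sum /trig !mul0r !addr0.
Qed.

Lemma partial_separated_sum_max u b c : (forall x, differentiable u x) ->
  partial ord_max (separated_sum u b c) = separated_sum (cst 0) c (- b).
Proof.
move=> du; apply/funext => t.
rewrite /partial derive_separated_sum // /separated_sum.
have -> : col' ord_max (delta_mx 0 ord_max) = 0 :> 'rV[R]_n.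
  by apply/rowP => k; rewrite !mxE eqxx eq_sym (negPf (neq_lift _ _)).
rewrite derive0 !mxE !eqxx; congr (_ + _).
by have /@derive_val := is_derive_trig b c (t 0 ord_max).
Qed.

Lemma smooth_differentiable u : smooth u -> forall x, differentiable u x.
Proof. by move/(_ [::]). Qed.

Lemma smooth_partial (l : 'I_n) u : smooth u -> smooth (partial l u).
Proof.
by move=> su s x; have := su (rcons s l) x; rewrite /iter_partial foldr_rcons.
Qed.

Lemma smooth_cst0 : smooth (cst 0 : 'rV[R]_n -> R).
Proof.
move=> s x; suff -> : iter_partial s (cst 0 : 'rV[R]_n -> R) = cst 0 by [].
elim: s => //= l s ->; apply/funext => y; exact: derive_cst.
Qed.

(** Separated sums with smooth first part are stable under every partial derivative: one of the
    first [n] directions kills the trigonometric part, the last direction kills [u]. Induction on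
    [s] then writes each iterated derivative as such a sum, which is differentiable. *)
Lemma smooth_separated_sum u b c : smooth u -> smooth (separated_sum u b c).
Proof.
move=> su s; suff [u' [b' [c' [su' ->]]]] : exists u' b' c', smooth u' /\
    iter_partial s (separated_sum u b c) = separated_sum u' b' c'.
  by move=> t; apply/differentiable_separated_sum/smooth_differentiable.
elim: s => [|k s [u' [b' [c' [su' IH]]]]] /=; first by exists u, b, c.
rewrite IH; have du' := smooth_differentiable su'.
case: (unliftP ord_max k) => [l|] ->.
  exists (partial l u'), 0, 0; split; first exact: smooth_partial.
  exact: partial_separated_sum_lift.
exists (cst 0), c', (- b'); split; first exact: smooth_cst0.
exact: partial_separated_sum_max.
Qed.

End SeparatedSums.

(** * Critical points and Hessians of separated functions on the torus *)

Lemma torus_col' (R : realType) (n : nat) (z : 'rV[R[i]]_n.+1) :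
  torus z -> torus (col' ord_max z).
Proof. by move=> zT k; rewrite mxE; apply: zT. Qed.

Lemma torus_torus_chart (R : realType) (m : nat) (z : 'rV[R[i]]_m) t :
  torus z -> torus (torus_chart z t).
Proof.
move=> zT k; rewrite mxE normrM zT mul1r normc_def /=.
by rewrite cos2Dsin2 sqrtr1.
Qed.

Lemma unit_real_pm1 (R : realType) (w : R[i]) : `|w| = 1 -> complex.Im w = 0 ->
  w = 1 \/ w = -1.
Proof.
case: w => p q /= w1 q0; rewrite q0 in w1 *; move: w1.
rewrite normc_def /= expr0n addr0 sqrtr_sqr => -[] /eqP.
rewrite eqr_norml ler01 andbT => /orP[] /eqP ->; [left|right] => //.
by apply/eqP; rewrite eq_complex /= oppr0 !eqxx.
Qed.

Section PerfectMorse.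
Variables (R : realType) (n : nat) (a : R).
Variables (g : 'rV[R[i]]_n -> R) (f : 'rV[R[i]]_n.+1 -> R).
Hypothesis a_neq0 : a != 0.
Hypothesis fE : forall z, torus z ->
  f z = g (col' ord_max z) + a * complex.Re (z 0 ord_max).
Implicit Types z : 'rV[R[i]]_n.+1.

(** Charts stay on the torus, so [fE] applies, and the real part of (p + iq)(cos s + i sin s) is p
    cos s - q sin s. *)
Lemma comp_torus_chart z : torus z ->
  f \o torus_chart z = separated_sum (g \o torus_chart (col' ord_max z))
    (a * complex.Re (z 0 ord_max)) (- (a * complex.Im (z 0 ord_max))).
Proof.
move=> zT; apply/funext => t /=; rewrite fE; last exact: torus_torus_chart.
congr (g _ + _); first by apply/rowP => k; rewrite !mxE.
by rewrite mxE /trig; case: (z 0 ord_max) => p q /=; ring.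
Qed.

Hypothesis g_smooth : torus_smooth g.

Let g_diff z : torus z ->
  forall x, differentiable (g \o torus_chart (col' ord_max z)) x.
Proof. by move=> zT; apply/smooth_differentiable/g_smooth/torus_col'. Qed.

Lemma separated_smooth : torus_smooth f.
Proof.
move=> z zT; rewrite comp_torus_chart //.
exact/smooth_separated_sum/g_smooth/torus_col'.
Qed.

Let col'0 : col' ord_max (0 : 'rV[R]_n.+1) = 0.
Proof. exact: linear0. Qed.

(** The first [n] partial derivatives at 0 are those of [g]; the last one is minus [a] times the
    imaginary part of the last coordinate. On the unit circle that part vanishes only at 1 and
    -1. *)
Lemma separated_criticalE z :
  critical_points f z <->
  [/\ torus z, critical_points g (col' ord_max z) &
      z 0 ord_max = 1 \/ z 0 ord_max = -1].
Proof.
have last0 : torus z -> partial ord_max (f \o torus_chart z) 0 =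
    - (a * complex.Im (z 0 ord_max)).
  move=> zT; rewrite comp_torus_chart // partial_separated_sum_max;
    last exact: g_diff.
  by rewrite /separated_sum /trig mxE cos0 sin0 mulr1 mulr0 addr0 add0r.
have lift0 l : torus z -> partial (lift ord_max l) (f \o torus_chart z) 0 =
    partial l (g \o torus_chart (col' ord_max z)) 0.
  move=> zT; rewrite comp_torus_chart // partial_separated_sum_lift;
    last exact: g_diff.
  by rewrite /separated_sum /trig !mul0r !addr0 col'0.
split=> [[zT zc]|[zT [_ zc] z1]].
  split=> //; first by split=> [|l]; [exact: torus_col'|rewrite -lift0].
  apply: unit_real_pm1 => //; move/eqP: (zc ord_max).
  by rewrite last0 // oppr_eq0 mulf_eq0 (negPf a_neq0) => /eqP.
split=> // k; case: (unliftP ord_max k) => [l|] ->; first by rewrite lift0.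
by rewrite last0 //; case: z1 => -> /=; rewrite ?oppr0 mulr0 oppr0.
Qed.

(** The mixed derivatives involving the last variable vanish, so expansion along the last row leaves
    only the diagonal term. *)
Lemma det_separated_hessian z : torus z ->
  \det (hessian f z) =
  - (a * complex.Re (z 0 ord_max)) * \det (hessian g (col' ord_max z)).
Proof.
move=> zT; have gd := g_diff zT.
have gs := g_smooth (torus_col' zT).
have d0 (x : 'rV[R]_n) : differentiable (cst 0 : _ -> R) x by [].
rewrite (expand_det_row _ ord_max) (bigD1 ord_max) //= big1 => [|k].
  rewrite addr0 mxE comp_torus_chart // !partial_separated_sum_max //.
  rewrite /separated_sum /trig mxE cos0 sin0 mulr1 mulr0 add0r addr0.
  (* The last diagonal cofactor has sign (-1)^(n + n) = 1. *)
  congr (_ * _); rewrite /cofactor addnn -signr_odd odd_double mul1r.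
  congr (\det _); apply/matrixP => i j.
  rewrite [LHS]mxE [LHS]mxE [LHS]mxE [RHS]mxE.
  rewrite comp_torus_chart; last exact: zT.
  rewrite partial_separated_sum_lift // partial_separated_sum_lift.
    by rewrite /separated_sum /trig !mul0r !addr0 col'0.
  exact/smooth_differentiable/smooth_partial.
(* Off-diagonal entries of the last row: differentiating along [lift ord_max l] leaves no dependence
   on the last variable. *)
case: (unliftP ord_max k) => [l|] -> //; last by rewrite eqxx.
rewrite mxE comp_torus_chart // partial_separated_sum_lift //.
rewrite partial_separated_sum_max; last first.
  exact/smooth_differentiable/smooth_partial.
by rewrite /separated_sum /trig !mxE oppr0 !mul0r !addr0 mul0r.
Qed.

(** Each critical point of [g] has two lifts. Those with last coordinate 1 keep the number given by
    [phi]; those with last coordinate -1 get that number plus [m]. *)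
Lemma separated_critical_card (m : nat) :
  (critical_points g #= `I_m)%card -> (critical_points f #= `I_(m + m))%card.
Proof.
move=> /card_set_bijP[phi [phi_to phi_inj phi_surj]].
have N1 : (1 : R[i]) != -1 by rewrite -addr_eq0 (pnatr_eq0 _ 2).
apply/card_set_bijP.
exists (fun z => (phi (col' ord_max z) + (z 0%R ord_max != 1%R) * m)%N); split.
- move=> z /separated_criticalE[_ zc _] /=.
  have /= lt_m := phi_to _ zc.
  case: eqP => _ /=; first by rewrite addn0 ltn_addr.
  by rewrite mul1n ltn_add2r.
- move=> y z.
  rewrite !inE => /separated_criticalE[_ yc y1] /separated_criticalE[_ zc z1].
  have /= yl := phi_to _ yc.
  have /= zl := phi_to _ zc.
  move=> yz.
  (* Numbers below [m] belong to last coordinate 1 and the others to -1, so equal numbers force the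
     same case. *)
  have yz1 : (y 0 ord_max != 1) = (z 0 ord_max != 1).
    move: yz; case: eqP => _; case: eqP => _ //=;
      rewrite mul0n mul1n addn0 => e.
      by move: yl; rewrite e ltnNge leq_addl.
    by move: zl; rewrite -e ltnNge leq_addl.
  have yzl : y 0 ord_max = z 0 ord_max.
    by move: yz1; case: y1 z1 => -> [] -> //; rewrite eqxx eq_sym N1.
  move: yz; rewrite yz1 => /addIn /phi_inj; rewrite !inE => /(_ yc zc) yzc.
  exact: row_lastP.
- move=> i /= im.
  have row_rconsP w e : critical_points g w -> e = 1 \/ e = -1 ->
      critical_points f (row_rcons w e).
    move=> wc e1; apply/separated_criticalE.
    rewrite col'_row_rcons row_rcons_last; split=> //.
    move=> k; rewrite mxE; case: unliftP => [l _|_]; first by case: wc.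
    by case: e1 => ->; rewrite ?normrN normr1.
  case: (ltnP i m) => [lt_im|le_mi].
    have [w wc wi] := phi_surj _ lt_im; exists (row_rcons w 1).
      by apply: row_rconsP; first exact: wc; left.
    by rewrite col'_row_rcons row_rcons_last eqxx addn0.
  have /phi_surj [w wc wi] : `I_m (i - m)%N by rewrite /= ltn_subLR.
  exists (row_rcons w (-1)).
    by apply: row_rconsP; first exact: wc; right.
  by rewrite col'_row_rcons row_rcons_last eq_sym N1 mul1n wi subnK.
Qed.

End PerfectMorse.

Lemma perfect_morse_separated (R : realType) (n : nat) (a : R)
    (g : 'rV[R[i]]_n -> R) (f : 'rV[R[i]]_n.+1 -> R) :
  a != 0 ->
  (forall z, torus z ->
    f z = g (col' ord_max z) + a * complex.Re (z 0 ord_max)) ->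
  perfect_morse g -> perfect_morse f.
Proof.
move=> a0 fE [[g_smooth g_nondeg] g_card]; split; last first.
  by rewrite expnS mul2n -addnn;
    exact: separated_critical_card a0 fE g_smooth _ g_card.
split; first exact: separated_smooth fE g_smooth.
move=> z /(separated_criticalE a0 fE g_smooth)[zT zc z1].
rewrite (det_separated_hessian fE) // mulf_neq0 ?g_nondeg //.
rewrite oppr_eq0 mulf_neq0 //.
by case: z1 => -> /=; rewrite ?oppr_eq0 oner_eq0.
Qed.

(** * Eigenvalues under addition of a scalar matrix *)

(** Substituting X - c for X is a ring morphism, hence commutes with the determinant. *)
Lemma char_poly_add_scalar (R : comNzRingType) (m : nat) (A : 'M[R]_m) (c : R) :
  char_poly (A + c%:M) = char_poly A \Po ('X - c%:P).
Proof.
rewrite /char_poly -[RHS](det_map_mx (comp_poly ('X - c%:P))).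
congr (\det _); apply/matrixP => i j; rewrite !mxE.
rewrite [RHS]raddfB /= comp_polyC raddfMn /= comp_polyX polyCD polyCMn.
case: (i == j); rewrite ?mulr1n ?mulr0n ?addr0 //.
by rewrite opprD addrCA addrC.
Qed.

Section Shift.
Variables (R : realType) (m : nat).
Implicit Type A : 'M[R[i]]_m.

Lemma eigenvaluesE A :
  char_poly A = \prod_(x <- eigenvalues A) ('X - x%:P).
Proof.
rewrite /eigenvalues; case: closed_field_poly_normal => s /= {1}->.
by rewrite (monicP (char_poly_monic A)) scale1r.
Qed.

(** Ensures that a band index is in range, so the default value of [nth] is never reached. *)
Lemma size_ordered_eigenvalues A : size (ordered_eigenvalues A) = m.
Proof.
rewrite size_sort size_map; apply/eqP; rewrite -eqSS.
by rewrite -(size_char_poly A) eigenvaluesE size_prod_XsubC.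
Qed.

(** A product of monic linear factors determines its roots up to permutation. *)
Lemma eigenvalues_add_scalar A (c : R[i]) :
  perm_eq (eigenvalues (A + c%:M)) [seq x + c | x <- eigenvalues A].
Proof.
apply: prod_XsubC_eq; rewrite -eigenvaluesE char_poly_add_scalar eigenvaluesE.
rewrite rmorph_prod big_map; apply: eq_bigr => x _ /=.
by rewrite comp_polyB comp_polyX comp_polyC polyCD opprD addrAC addrA.
Qed.

(** Translation by a real number preserves the order, hence commutes with sorting, and it commutes
    with taking real parts. *)
Lemma ordered_eigenvalues_add_scalar A (c : R) :
  ordered_eigenvalues (A + (c%:C)%C%:M) =
  [seq x + c | x <- ordered_eigenvalues A].
Proof.
rewrite /ordered_eigenvalues.
have sortc (s : seq R) :
    [seq x + c | x <- sort <=%R s] = sort <=%R [seq x + c | x <- s].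
  rewrite sort_map; congr map; congr sort.
  by apply/funext => x; apply/funext => y; rewrite /= lerD2r.
rewrite sortc; apply/perm_sort_leP.
apply: (perm_trans (perm_map _ (eigenvalues_add_scalar A _))).
rewrite -!map_comp; set t := map _ _; set t' := map _ _.
by have -> : t = t' by apply: eq_map => -[].
Qed.

End Shift.

(** * The Floquet matrix of the parallel extension *)

Lemma zmonomial_last (R : realType) (d : nat)
    (z : 'rV[R[i]]_d.+1) (x : 'rV[int]_d.+1) :
  zmonomial z x =
  zmonomial (col' ord_max z) (col' ord_max x) * z 0 ord_max ^ x 0 ord_max.
Proof.
rewrite /zmonomial big_ord_recr /=; congr (_ * _); apply: eq_bigr => k _.
have -> : widen_ord (leqnSn d) k = lift ord_max k.
  by apply: val_inj; rewrite [RHS]lift_max.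
by rewrite !mxE.
Qed.

Lemma zmonomial0 (R : realType) (d : nat) (z : 'rV[R[i]]_d) :
  zmonomial z 0 = 1.
Proof. by rewrite /zmonomial big1 // => k _; rewrite mxE expr0z. Qed.

Section PeriodicGraph.
Variables (d : nat) (G : periodic_graph d).

Lemma act_inj x y (v : G) : act x v = act y v -> x = y.
Proof.
move=> xy; apply/eqP; rewrite -subr_eq0; apply/eqP/(@act_free _ G _ v).
by rewrite addrC actD xy -actD addNr act0.
Qed.

(** Sending [x] to the orbit of the edge from [v] to [act x u] is injective, and there are finitely
    many edge orbits. *)
Lemma finite_adj (v u : G) : finite_set [set x | adj v (act x u)].
Proof.
have [N [e eP]] := edge_orbits G.
(* A nonempty set provides an element of ['I_N], needed as the value of [phi] at translations that
   give no edge. *)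
have [i0|iV] := pselect (exists x, adj v (act x u)); last first.
  rewrite (_ : [set _ | _] = set0) //.
  by apply/seteqP; split=> // x h; case: iV; exists x.
have {}eP x : exists i : 'I_N, adj v (act x u) ->
    exists y, v = act y (e i).1 /\ act x u = act y (e i).2.
  have [/eP[i [y ?]]|nadj] := pselect (adj v (act x u)).
    by exists i => _; exists y.
  by case: i0 => y /eP[i _]; exists i => /nadj.
have /choice[phi phiP] := eP.
(* If [x] and [y] share an orbit index, the common first endpoint [v] forces the same translation by
   freeness; the second endpoints then agree, so [x = y]. *)
have phi_inj : set_inj [set x | adj v (act x u)] phi.
  move=> x y; rewrite !inE => /phiP[s [vs xs]] /phiP[t [vt yt]] xy.
  rewrite xy in vs xs; have st : s = t.
    by apply: (@act_inj _ _ (e (phi y)).1); rewrite -vs vt.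
  by apply: (@act_inj _ _ u); rewrite xs yt st.
rewrite -(eq_finite_set (inj_card_eq phi_inj)); exact: finite_finset.
Qed.

Lemma rep_inj (v u : 'I_(nrep G)) (x : 'rV[int]_d) :
  rep v = act x (rep u) -> v = u /\ x = 0.
Proof.
move=> vu; have [w [_ wU]] := rep_orbit (rep v).
have wv : w = v by apply: wU; exists 0; rewrite act0.
have wu : w = u by apply: wU; exists x.
have vE : v = u by rewrite -wv.
by split=> //; apply: (@act_free _ G _ (rep u)); rewrite -vu vE.
Qed.

(** An edge inside a layer comes from [G] and has last coordinate 0. An edge between layers joins
    two copies of one vertex, so by [rep_inj] it occurs only for [v = u], with zero translation in
    [G] and last coordinate 1 or -1. *)
Lemma parallel_adj_set (v u : 'I_(nrep G)) :
  [set x | par_adj (par_rep v) (par_act x (par_rep u))] =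
  [set row_rcons x 0 | x in [set x | adj (rep v) (act x (rep u))]] `|`
  [set x | v = u /\ (x = row_rcons 0 1 \/ x = row_rcons 0 (-1))].
Proof.
apply/seteqP; split=> x /=.
  rewrite /par_adj /par_act /= addr0 add0r => -[[/rep_inj[<- x0] x1]|[x1 vu]].
    right; split=> //; case: x1 => x1; [left|right];
      apply: row_lastP; rewrite ?col'_row_rcons ?row_rcons_last //.
    by apply/eqP; rewrite -addr_eq0 -x1.
  left; exists (col' ord_max x) => //.
  by apply: row_lastP; rewrite ?col'_row_rcons ?row_rcons_last.
rewrite /par_adj /par_act /= addr0 add0r => -[[y yA <-]|[-> [->|->]]];
  rewrite col'_row_rcons row_rcons_last ?act0.
- by right.
- by left; split=> //; left.
- by left; split=> //; right.
Qed.

End PeriodicGraph.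

Section ParallelFloquet.
Variables (R : realType) (d : nat) (G : periodic_graph d) (L : labeling R G).
Variable a : R.

Lemma floquet_parallel (z : 'rV[R[i]]_d.+1) :
  floquet (parallel_labeling L a) z = floquet L (col' ord_max z) +
    ((a%:C)%C * (z 0 ord_max + (z 0 ord_max)^-1))%:M.
Proof.
apply/matrixP => v u; rewrite !mxE -addrA; congr (_ + _).
(* The two index sets are finite, and disjoint by their last coordinates: 0 against 1 or -1. *)
rewrite [in LHS]parallel_adj_set fsbigU0 /=; first last.
- move=> x [[y _ <-] [_ [|]]] /(congr1 (fun x : 'rV_d.+1 => x 0 ord_max));
    by rewrite !row_rcons_last.
- apply: (@sub_finite_set _ _ [set row_rcons 0 1; row_rcons 0 (-1)]).
    by move=> x [_ [->|->]]; [left|right].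
  exact: finite_set2.
- exact/finite_image/finite_adj.
congr (_ + _).
  rewrite fsbig_image; last first.
    by move=> x y _ _ xy; rewrite -[x](col'_row_rcons _ 0) xy col'_row_rcons.
  apply: eq_fsbigr => x _.
  rewrite zmonomial_last row_rcons_last expr0z mulr1 col'_row_rcons.
  by rewrite /par_elabel /par_act /= row_rcons_last addr0 eqxx col'_row_rcons.
(* The edges between layers: an empty sum off the diagonal, two terms on it. *)
have [<-|vu] := eqVneq v u; last first.
  rewrite mulr0n (_ : [set x | _] = set0) ?fsbig_set0 //.
  by apply/seteqP; split=> x // -[vu' _]; rewrite vu' eqxx in vu.
rewrite (_ : [set x | _] = [set row_rcons 0 1] `|` [set row_rcons 0 (-1)]);
  last first.
  apply/seteqP; split=> x /=.
    by case=> _ [->|->]; [left|right].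
  by case=> ->; split=> //; [left|right].
rewrite fsbigU0 /=; [|exact: finite_set1|exact: finite_set1|]; last first.
  move=> x [-> /(congr1 (fun x : 'rV_d.+1 => x 0 ord_max))].
  by rewrite !row_rcons_last.
rewrite !fsbig_set1 !zmonomial_last !col'_row_rcons !row_rcons_last.
rewrite /par_elabel /par_act /= !row_rcons_last zmonomial0 /=.
by rewrite !mul1r expr1z exprN1 mulrDr mulr1n.
Qed.

Lemma band_parallel (j : 'I_(nrep G)) (z : 'rV[R[i]]_d.+1) : torus z ->
  band (parallel_labeling L a) j z =
  band L j (col' ord_max z) + a *+ 2 * complex.Re (z 0 ord_max).
Proof.
move=> zT; rewrite /band floquet_parallel.
have -> : (a%:C)%C * (z 0 ord_max + (z 0 ord_max)^-1) =
    ((a *+ 2 * complex.Re (z 0 ord_max))%:C)%C.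
  (* On the unit circle the inverse is the conjugate, so the scalar is real. *)
  rewrite invC_norm zT expr1n invr1 mul1r.
  case: (z 0 ord_max) => p q; apply/eqP; rewrite eq_complex /=.
  by apply/andP; split; apply/eqP; ring.
rewrite ordered_eigenvalues_add_scalar (nth_map 0) //.
by rewrite size_ordered_eigenvalues.
Qed.

End ParallelFloquet.

Theorem corollary4p3 (R : realType) (d : nat) (d_gt0 : (0 < d)%N)
    (G : periodic_graph d) (L : labeling R G) :
  (forall j : 'I_(nrep G), perfect_morse (band L j)) ->
  forall a : R, a != 0 ->
  forall j : 'I_(nrep (parallel_graph G)),
    perfect_morse (band (parallel_labeling L a) j).
Proof.
move=> Lperfect a a_neq0 j.
(* The coefficient is 2a because w + 1/w is twice the real part of w for unit w. *)
apply: (@perfect_morse_separated _ _ (a *+ 2) (band L j)) => //.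
  by rewrite mulrn_eq0.
by move=> z zT; apply: band_parallel.
Qed.
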